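(* Let $\rho\in(0,1)$. (i) If $0<\phi\le2/3$, then, wherever the initial state in $\Delta$ is located, the greedy strategy chooses game $B$ forever except for an initial finite number of turns. In particular, the discrete dynamical system has a globally asymptotically stable equilibrium, namely $\boldsymbol\pi$, the stationary distribution of $\boldsymbol P_B$. (ii) If $2/3<\phi<1$, then game $B$ is chosen forever (that is, from some turn on) only when $\phi<\phi_2$, and only when the initial state belongs to one of the following (at most four, since some may be empty) one-dimensional regions: $$R_1:=\Big\{x\in\Delta_B:\Big(1+\tfrac{S}{1+\rho^2}\Big)(x_0-\pi_0)+2(x_1-\pi_1)=0\Big\},$$ $$R_2:=\{x\in\Delta_A:x_1=f(x_0)\},\qquad R_3:=\{x\in\Delta_B:x_1=g(x_0)\},\qquad R_4:=\{x\in\Delta_B:x_1=h(x_0)\}.$$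
   Context: Fix $\rho\in(0,1)$ and $\phi\in(0,1]$. Put $p_0:=\rho^2/(1+\rho^2)$, $p_1:=1/(1+\rho)$, $$\boldsymbol P_B^\circ:=\begin{pmatrix}0&p_0&1-p_0\\ 1-p_1&0&p_1\\ p_1&1-p_1&0\end{pmatrix},\qquad \boldsymbol P_A^\circ:=\begin{pmatrix}0&1/2&1/2\\ 1/2&0&1/2\\ 1/2&1/2&0\end{pmatrix},$$ $\boldsymbol P_A:=(1-\phi)\boldsymbol I+\phi\boldsymbol P_A^\circ$, $\boldsymbol P_B:=(1-\phi)\boldsymbol I+\phi\boldsymbol P_B^\circ$. The unique stationary distribution of $\boldsymbol P_B$ is $\boldsymbol\pi=(\pi_0,\pi_1,\pi_2)$ with $\pi_0=\frac{1+\rho^2}{2(1+\rho+\rho^2)}$, $\pi_1=\frac{\rho(1+\rho)}{2(1+\rho+\rho^2)}$, $\pi_2=\frac{1+\rho}{2(1+\rho+\rho^2)}$. Let $\Delta:=\{(x_0,x_1,x_2):x_i\ge0,\ x_0+x_1+x_2=1\}$ (row vectors), $\Delta_A:=\{x\in\Delta:x_0\ge\pi_0\}$, $\Delta_B:=\Delta-\Delta_A$. The discrete dynamical system of the greedy strategy is $x(n+1)=F(x(n))$, $n\ge0$, where $F(x):=x\boldsymbol P_A$ if $x\in\Delta_A$ (game $A$ is chosen) and $F(x):=x\boldsymbol P_B$ if $x\in\Delta_B$ (game $B$ is chosen). Put $S:=\sqrt{(1+\rho^2)(1+4\rho+\rho^2)}$ and $$\phi_2:=\frac{2(1+\rho)(1+\rho^2)}{3(1+\rho)(1+\rho^2)-(1-\rho)S}.$$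 The functions used in part (ii) (where $\phi>2/3$) are $$f(x):=-\tfrac12\Big(1+\tfrac{S}{1+\rho^2}\Big)x+\frac{2(\phi-2\pi_1)(1+\rho^2)+(\phi-2\pi_0)(1+\rho^2+S)}{2(3\phi-2)(1+\rho^2)},$$ $$g(x):=-\tfrac12\Big(1+\tfrac{S}{1+\rho^2}\Big)x+\frac{g_1}{(3\phi-2)g_2},\qquad h(x):=-\tfrac12\Big(1+\tfrac{S}{1+\rho^2}\Big)x+\frac{h_1}{(3\phi-2)h_2},$$ with $g_1:=\phi(3\phi-2)[(1+2\rho)(1+\rho^2)+S]-(1+\rho)[2(\phi-2\pi_1)(1+\rho^2)+(\phi-2\pi_0)(1+\rho^2+S)]$, $g_2:=(3\phi-2)(1+\rho)(1+\rho^2)+\phi(1-\rho)S$, $h_1:=\phi(3\phi-2)\{2(1+\rho)[(1+2\rho)(1+\rho^2)+S]-\phi[2+6\rho+3\rho^2+4\rho^3+3\rho^4+(2+2\rho-\rho^2)S]\}-(1+\rho)^2[2(\phi-2\pi_1)(1+\rho^2)+(\phi-2\pi_0)(1+\rho^2+S)]$, $h_2:=-2(1+\rho)^2(1+\rho^2)+6\phi(1+\rho)^2(1+\rho^2)-\phi^2(5+10\rho+6\rho^2+10\rho^3+5\rho^4)-\phi(3\phi-2)(1-\rho^2)S$. For $2/3<\phi<\phi_2$, the four regions $R_1,\dots,R_4$ are those of initial states from which the sequence of games chosen is, respectively, $BBB\cdots$; $A$ followed by $BBB\cdots$; $BA$ followed by $BBB\cdots$; $BBA$ followed by $BBB\c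dots$.
   Formalization: In (i), π lies in Δ_A, so F(π)=πP_A≠π and π is not an equilibrium of F; proved instead: every greedy trajectory from Δ converges to π, and π is a globally asymptotically stable equilibrium of x↦xP_B on Δ and its unique stationary distribution. *)

(* Defs.v *)
From HB Require Import structures.
From mathcomp Require Import all_boot all_order all_algebra.
From mathcomp Require Import all_classical all_reals all_analysis.
Set Implicit Arguments.
Unset Strict Implicit.
Unset Printing Implicit Defensive.
Import Order.TTheory GRing.Theory Num.Theory numFieldNormedType.Exports.
Local Open Scope classical_set_scope.
Local Open Scope ring_scope.

Inductive game := GameA | GameB.

Section GreedyStrategy.
Variables (R : realType) (rho phi : R).

Definition row3 (a b c : R) : 'rV[R]_3 := \row_j [:: a; b; c]`_j.

Definition mx3 (r0 r1 r2 : 'rV[R]_3) : 'M[R]_3 :=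
  \matrix_(i, j) (nth 0 [:: r0; r1; r2] i) 0 j.

Definition simplex : set 'rV[R]_3 :=
  [set x | (forall i, 0 <= x 0 i) /\ x 0 0 + x 0 1 + x 0 2 = 1].

Definition p0 : R := rho ^+ 2 / (1 + rho ^+ 2).
Definition p1 : R := 1 / (1 + rho).

Definition PAo : 'M[R]_3 :=
  mx3 (row3 0 (1 / 2) (1 / 2))
      (row3 (1 / 2) 0 (1 / 2))
      (row3 (1 / 2) (1 / 2) 0).

Definition PBo : 'M[R]_3 :=
  mx3 (row3 0 p0 (1 - p0))
      (row3 (1 - p1) 0 p1)
      (row3 p1 (1 - p1) 0).

Definition PA : 'M[R]_3 := (1 - phi) *: 1%:M + phi *: PAo.
Definition PB : 'M[R]_3 := (1 - phi) *: 1%:M + phi *: PBo.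

Definition pi0 : R := (1 + rho ^+ 2) / (2 * (1 + rho + rho ^+ 2)).
Definition pi1 : R := rho * (1 + rho) / (2 * (1 + rho + rho ^+ 2)).
Definition pi2 : R := (1 + rho) / (2 * (1 + rho + rho ^+ 2)).
Definition piB : 'rV[R]_3 := row3 pi0 pi1 pi2.

Definition stationary (P : 'M[R]_3) (x : 'rV[R]_3) : Prop :=
  simplex x /\ x *m P = x.

Definition simplexA : set 'rV[R]_3 := [set x | simplex x /\ pi0 <= x 0 0].
Definition simplexB : set 'rV[R]_3 := simplex `\` simplexA.

(* On the simplex, [greedy x = GameA] iff [simplexA x], and
   [greedy x = GameB] iff [simplexB x]. *)
Definition greedy (x : 'rV[R]_3) : game :=
  if pi0 <= x 0 0 then GameA else GameB.

Definition transition (g : game) : 'M[R]_3 :=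
  match g with GameA => PA | GameB => PB end.

Definition F (x : 'rV[R]_3) : 'rV[R]_3 := x *m transition (greedy x).

Definition trajectory (x : 'rV[R]_3) (n : nat) : 'rV[R]_3 := iter n F x.

Definition eventually_B (x : 'rV[R]_3) : Prop :=
  exists N : nat, forall n : nat, (N <= n)%N -> greedy (trajectory x n) = GameB.

(* [piB] lies in [simplexA], so it is not a fixed point of [F], and points of
   [simplexA] near [piB] are thrown away from it.  The notion below is
   therefore meant for [x |-> x *m PB], the map that [F] eventually coincides
   with along a trajectory choosing game B forever. *)
Definition globally_asymptotically_stable (D : set 'rV[R]_3)
    (G : 'rV[R]_3 -> 'rV[R]_3) (e : 'rV[R]_3) : Prop :=
  [/\ D e /\ G e = e,
      forall eps : R, 0 < eps -> exists2 delta : R, 0 < delta &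
        forall x, D x -> `|x - e| < delta ->
          forall n : nat, `|iter n G x - e| < eps
    & forall x, D x -> iter n G x @[n --> \oo] --> e].

Definition Sroot : R :=
  Num.sqrt ((1 + rho ^+ 2) * (1 + 4 * rho + rho ^+ 2)).

Definition phi2 : R :=
  2 * (1 + rho) * (1 + rho ^+ 2) /
  (3 * (1 + rho) * (1 + rho ^+ 2) - (1 - rho) * Sroot).

Definition f (x : R) : R :=
  - (1 / 2) * (1 + Sroot / (1 + rho ^+ 2)) * x
  + (2 * (phi - 2 * pi1) * (1 + rho ^+ 2)
     + (phi - 2 * pi0) * (1 + rho ^+ 2 + Sroot))
    / (2 * (3 * phi - 2) * (1 + rho ^+ 2)).

Definition g1 : R :=
  phi * (3 * phi - 2) * ((1 + 2 * rho) * (1 + rho ^+ 2) + Sroot)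
  - (1 + rho) * (2 * (phi - 2 * pi1) * (1 + rho ^+ 2)
                 + (phi - 2 * pi0) * (1 + rho ^+ 2 + Sroot)).

Definition g2 : R :=
  (3 * phi - 2) * (1 + rho) * (1 + rho ^+ 2) + phi * (1 - rho) * Sroot.

Definition g (x : R) : R :=
  - (1 / 2) * (1 + Sroot / (1 + rho ^+ 2)) * x + g1 / ((3 * phi - 2) * g2).

Definition h1 : R :=
  phi * (3 * phi - 2)
    * (2 * (1 + rho) * ((1 + 2 * rho) * (1 + rho ^+ 2) + Sroot)
       - phi * (2 + 6 * rho + 3 * rho ^+ 2 + 4 * rho ^+ 3 + 3 * rho ^+ 4
                + (2 + 2 * rho - rho ^+ 2) * Sroot))
  - (1 + rho) ^+ 2 * (2 * (phi - 2 * pi1) * (1 + rho ^+ 2)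
                      + (phi - 2 * pi0) * (1 + rho ^+ 2 + Sroot)).

Definition h2 : R :=
  - 2 * (1 + rho) ^+ 2 * (1 + rho ^+ 2)
  + 6 * phi * (1 + rho) ^+ 2 * (1 + rho ^+ 2)
  - phi ^+ 2 * (5 + 10 * rho + 6 * rho ^+ 2 + 10 * rho ^+ 3 + 5 * rho ^+ 4)
  - phi * (3 * phi - 2) * (1 - rho ^+ 2) * Sroot.

Definition h (x : R) : R :=
  - (1 / 2) * (1 + Sroot / (1 + rho ^+ 2)) * x + h1 / ((3 * phi - 2) * h2).

Definition R1 : set 'rV[R]_3 := [set x | simplexB x /\
  (1 + Sroot / (1 + rho ^+ 2)) * (x 0 0 - pi0) + 2 * (x 0 1 - pi1) = 0].
Definition R2 : set 'rV[R]_3 := [set x | simplexA x /\ x 0 1 = f (x 0 0)].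
Definition R3 : set 'rV[R]_3 := [set x | simplexB x /\ x 0 1 = g (x 0 0)].
Definition R4 : set 'rV[R]_3 := [set x | simplexB x /\ x 0 1 = h (x 0 0)].

End GreedyStrategy.

(* Main.v *)
Require Import Defs.
From HB Require Import structures.
From mathcomp Require Import all_boot all_order all_algebra.
From mathcomp Require Import all_classical all_reals all_analysis.
From mathcomp Require Import ring lra.
Set Implicit Arguments.
Unset Strict Implicit.
Unset Printing Implicit Defensive.
Import Order.TTheory GRing.Theory Num.Theory numFieldNormedType.Exports.
Local Open Scope classical_set_scope.
Local Open Scope ring_scope.

(** On the row vectors of mass one, P_B has the fixed point pi and two
eigenforms vanishing at pi, with eigenvalues lam(s) <= lam(-s); their
difference has the sign of x_0 - pi_0, so game B is chosen iff
eigform s < eigform (-s).  Game A is the homothety of ratio 1 - 3 phi / 2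
centred at the uniform vector.

For phi <= 2/3 one has |lam(s)| <= lam(-s) < 1, and the cone
|eigform s| < eigform (-s) is a region of game B that contains the uniform
vector and is invariant.  Outside the cone, |eigform s| - eigform (-s) never
grows and drops by a fixed amount whenever game A is played, so the cone is
reached unless A is played only finitely often.

For phi > 2/3, lam(s) is negative and dominant, so choosing B forever forces
eigform s = 0 and lam(-s) > 0, that is phi < phi2.  Pulling the line
eigform s = 0 back along the games gives parallel lines: R2 through A, then R3
and R4 through B.  Two A's in a row are impossible as pi_0 > 1/3, and bounds of
eigform s on the simplex exclude any other predecessor. *)

(** * Spectrum of game B *)

Section Spectral.
Variables (R : realType) (rho : R).
Hypothesis rho01 : 0 < rho < 1.
Implicit Types (phi t : R) (x : 'rV[R]_3).

Definition sroot : R := Sroot rho / (1 + rho ^+ 2).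

(* The eigenvalues of PBo other than 1 are (-1 - gap) / 2 and
   (-1 + gap) / 2. *)
Definition gap : R := (1 - rho) * sroot / (1 + rho).

(** Forms an eigenpair of [PB] with [eigform t] when t^2 (1 + rho^2) = 1 + 4 rho + rho^2, that is
    for t = [sroot] or t = [- sroot]; t stays free so that both signs share one computation. *)
Definition eigval (phi t : R) : R :=
  1 - 3 / 2 * phi - phi * ((1 - rho) * t / (1 + rho)) / 2.

Definition eigform (t : R) (x : 'rV[R]_3) : R :=
  (1 + t) * (x 0 0 - pi0 rho) + 2 * (x 0 1 - pi1 rho).

Definition unif3 : 'rV[R]_3 := row3 (1 / 3) (1 / 3) (1 / 3).

Definition mass_one (x : 'rV[R]_3) : Prop := x 0 0 + x 0 1 + x 0 2 = 1.

Lemma onesq_gt0 : 0 < 1 + rho ^+ 2.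
Proof. by rewrite ltr_wpDr ?sqr_ge0. Qed.

Lemma radicand_gt0 : 0 < 1 + 4 * rho + rho ^+ 2.
Proof. have /andP[r0 r1] := rho01; have b := onesq_gt0; lra. Qed.

Lemma q_gt0 : 0 < 1 + rho + rho ^+ 2.
Proof. have /andP[r0 r1] := rho01; have b := onesq_gt0; lra. Qed.

Lemma Sroot_sq : Sroot rho ^+ 2 = (1 + rho ^+ 2) * (1 + 4 * rho + rho ^+ 2).
Proof. by rewrite sqr_sqrtr // mulr_ge0 // ltW // ?onesq_gt0 ?radicand_gt0. Qed.

Lemma sroot_gt0 : 0 < sroot.
Proof.
by rewrite /sroot /Sroot divr_gt0 ?sqrtr_gt0 ?mulr_gt0 ?onesq_gt0 ?radicand_gt0.
Qed.

Lemma sroot_sq : sroot ^+ 2 * (1 + rho ^+ 2) = 1 + 4 * rho + rho ^+ 2.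
Proof.
have b := onesq_gt0; rewrite /sroot exprMn Sroot_sq.
by field; lra.
Qed.

Lemma sroot_gt1 : 1 < sroot.
Proof.
have /andP[r0 r1] := rho01; have s0 := sroot_gt0; have b := onesq_gt0.
rewrite -(@ltr_pXn2r _ 2) ?nnegrE ?ltW // expr1n -(ltr_pM2r b) sroot_sq; lra.
Qed.

(** After squaring and clearing the denominator, the difference is 2 (1 - rho)^2 + 1 + rho^2. *)
Lemma sroot_lt2 : sroot < 2.
Proof.
have /andP[r0 r1] := rho01; have s0 := sroot_gt0; have b := onesq_gt0.
have e := sqr_ge0 (1 - rho).
rewrite -(@ltr_pXn2r _ 2) ?nnegrE ?ltW // -(ltr_pM2r b) sroot_sq; nra.
Qed.

Lemma gapE : gap * (1 + rho) = (1 - rho) * sroot.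
Proof. by have /andP[r0 r1] := rho01; rewrite /gap; field; lra. Qed.

Lemma gap_gt0 : 0 < gap.
Proof.
have /andP[r0 r1] := rho01; apply: divr_gt0; last lra.
by apply: mulr_gt0 sroot_gt0; lra.
Qed.

(** After squaring and clearing denominators, the two sides differ by 8 rho^2. *)
Lemma gap_lt1 : gap < 1.
Proof.
have /andP[r0 r1] := rho01; have d0 := gap_gt0; have b := onesq_gt0.
have r2 : 0 < rho ^+ 2 by rewrite exprn_gt0.
have b' : 0 < (1 + rho) ^+ 2 * (1 + rho ^+ 2).
  by rewrite mulr_gt0 ?exprn_gt0 //; lra.
rewrite -(@ltr_pXn2r _ 2) ?nnegrE ?ltW // expr1n -(ltr_pM2r b').
have -> : gap ^+ 2 * ((1 + rho) ^+ 2 * (1 + rho ^+ 2)) =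
    (1 - rho) ^+ 2 * (1 + 4 * rho + rho ^+ 2).
  by rewrite -sroot_sq mulrA -exprMn gapE; ring.
nra.
Qed.

Lemma eigval_sroot phi : eigval phi sroot = 1 - 3 / 2 * phi - phi * gap / 2.
Proof. by []. Qed.

Lemma eigval_srootN phi : eigval phi (- sroot) = 1 - 3 / 2 * phi + phi * gap / 2.
Proof. by rewrite /eigval /gap; ring. Qed.

(** Identifies [phi2] as the value of phi at which [eigval phi (- sroot)] vanishes. *)
Lemma phi2E : phi2 rho = 2 / (3 - gap).
Proof.
have /andP[r0 r1] := rho01; have b := onesq_gt0; have d1 := gap_lt1.
have S : Sroot rho = sroot * (1 + rho ^+ 2) by rewrite /sroot divfK //; lra.
rewrite /phi2 S.
have -> : 3 * (1 + rho) * (1 + rho ^+ 2) - (1 - rho) * (sroot * (1 + rho ^+ 2))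
    = (3 - gap) * ((1 + rho) * (1 + rho ^+ 2)).
  by rewrite [(1 - rho) * _]mulrA -gapE; ring.
by field; rewrite !lt0r_neq0 //; lra.
Qed.

(** * Action of the two games on row vectors *)

Lemma mulmx3E (x : 'rV[R]_3) (P : 'M[R]_3) j :
  (x *m P) 0 j = x 0 0 * P 0 j + x 0 1 * P 1 j + x 0 2 * P 2 j.
Proof.
rewrite mxE !big_ord_recl big_ord0 addr0 addrA.
congr (_ + _ * _ + _ * _); congr (_ _ _); exact/val_inj.
Qed.

Lemma I3_ind (P : 'I_3 -> Prop) : P 0 -> P 1 -> P 2 -> forall i, P i.
Proof.
move=> h0 h1 h2 [[|[|[|//]]] i3].
- by rewrite (_ : Ordinal i3 = 0) //; apply/val_inj.
- by rewrite (_ : Ordinal i3 = 1) //; apply/val_inj.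
- by rewrite (_ : Ordinal i3 = 2) //; apply/val_inj.
Qed.

Lemma row3_eq (x y : 'rV[R]_3) :
  x 0 0 = y 0 0 -> x 0 1 = y 0 1 -> x 0 2 = y 0 2 -> x = y.
Proof. by move=> h0 h1 h2; apply/rowP; apply: I3_ind. Qed.

Lemma simplex_mass_one x : simplex x -> mass_one x.
Proof. by case. Qed.

Lemma mass_oneE x : mass_one x -> x 0 2 = 1 - x 0 0 - x 0 1.
Proof. by move=> <-; ring. Qed.

Lemma mulPAE phi x : mass_one x ->
  forall j, (x *m PA phi) 0 j = phi / 2 + (1 - 3 / 2 * phi) * x 0 j.
Proof.
move=> /mass_oneE h; apply: I3_ind; rewrite mulmx3E h !mxE /=; by field.
Qed.

Lemma mulPB0 phi x : (x *m PB rho phi) 0 0 =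
  (1 - phi) * x 0 0 + phi * (rho * x 0 1 + x 0 2) / (1 + rho).
Proof.
have /andP[r0 r1] := rho01.
rewrite mulmx3E !mxE /= /p0 /p1; by field; lra.
Qed.

Lemma mulPB1 phi x : (x *m PB rho phi) 0 1 =
  (1 - phi) * x 0 1
  + phi * (rho ^+ 2 / (1 + rho ^+ 2) * x 0 0 + rho / (1 + rho) * x 0 2).
Proof.
have /andP[r0 r1] := rho01; have b := onesq_gt0.
rewrite mulmx3E !mxE /= /p0 /p1; by field; rewrite !lt0r_neq0 //; lra.
Qed.

Lemma mulPB2 phi x : (x *m PB rho phi) 0 2 =
  (1 - phi) * x 0 2 + phi * (1 / (1 + rho ^+ 2) * x 0 0 + 1 / (1 + rho) * x 0 1).
Proof.
have /andP[r0 r1] := rho01; have b := onesq_gt0.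
rewrite mulmx3E !mxE /= /p0 /p1; by field; rewrite !lt0r_neq0 //; lra.
Qed.

Lemma mulPA_mass_one phi x : mass_one x -> mass_one (x *m PA phi).
Proof.
by move=> h; rewrite /mass_one !mulPAE // (mass_oneE h); field.
Qed.

Lemma mulPB_mass_one phi x : mass_one x -> mass_one (x *m PB rho phi).
Proof.
have /andP[r0 r1] := rho01; have b := onesq_gt0.
move=> h; rewrite /mass_one mulPB0 // mulPB1 // mulPB2 // (mass_oneE h).
by field; rewrite !lt0r_neq0 //; lra.
Qed.

Lemma mulPA_simplex phi x : 0 <= phi <= 1 -> simplex x -> simplex (x *m PA phi).
Proof.
move=> /andP[p0 p1] [hx h]; split; last exact: mulPA_mass_one.
move=> j; rewrite mulPAE //.
have x0 := hx j; have x1 : x 0 j <= 1.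
  have [a0 [a1 a2]] := (hx 0, (hx 1, hx 2)).
  by move: j {x0}; apply: I3_ind; lra.
nra.
Qed.

Lemma mulPB_simplex phi x :
  0 <= phi <= 1 -> simplex x -> simplex (x *m PB rho phi).
Proof.
have /andP[r0 r1] := rho01; have b := onesq_gt0.
move=> /andP[p0 p1] [hx h]; split; last exact: mulPB_mass_one.
have [a0 [a1 a2]] := (hx 0, (hx 1, hx 2)).
have c0 : 0 <= (1 + rho)^-1 by rewrite invr_ge0; lra.
have c1 : 0 <= (1 + rho ^+ 2)^-1 by rewrite invr_ge0 ltW.
have c2 : 0 <= 1 - phi by lra.
have r0' := ltW r0.
by apply: I3_ind; rewrite ?(mulPB0, mulPB1, mulPB2) //;
  repeat first [exact: ler01 | assumption | apply: exprn_ge0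
               | apply: addr_ge0 | apply: mulr_ge0].
Qed.

(** Reduces to 3 (1 + rho^2) - 2 (1 + rho + rho^2) = (1 - rho)^2 > 0. *)
Lemma pi0_gt : 1 / 3 < pi0 rho.
Proof.
have /andP[r0 r1] := rho01; have c := q_gt0; rewrite /pi0.
rewrite ltr_pdivlMr; last lra.
have e : 0 < (1 - rho) ^+ 2 by rewrite exprn_gt0 //; lra.
nra.
Qed.

Lemma pi_ge0 : [/\ 0 <= pi0 rho, 0 <= pi1 rho & 0 <= pi2 rho].
Proof.
have /andP[r0 r1] := rho01; have c := q_gt0; have b := onesq_gt0.
by split; rewrite !(divr_ge0, mulr_ge0) //; lra.
Qed.

Lemma simplex_piB : simplex (piB rho).
Proof.
have c := q_gt0; have [a0 a1 a2] := pi_ge0.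
split; first by apply: I3_ind; rewrite !mxE.
by rewrite !mxE /= /pi0 /pi1 /pi2; field; lra.
Qed.

Lemma piB_mulPB phi : piB rho *m PB rho phi = piB rho.
Proof.
have h := simplex_mass_one simplex_piB.
have /andP[r0 r1] := rho01; have c := q_gt0; have b := onesq_gt0.
by apply: row3_eq; rewrite ?mulPB0 ?mulPB1 ?mulPB2 // !mxE /= /pi0 /pi1 /pi2;
  field; rewrite !lt0r_neq0 //; lra.
Qed.

Lemma eigform_mulPB phi t x : t ^+ 2 * (1 + rho ^+ 2) = 1 + 4 * rho + rho ^+ 2 ->
  mass_one x -> eigform t (x *m PB rho phi) = eigval phi t * eigform t x.
Proof.
have /andP[r0 r1] := rho01; have c := q_gt0; have b := onesq_gt0.
move=> ht h; rewrite /eigform /eigval mulPB0 // mulPB1 // (mass_oneE h).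
(* The condition on t, solved for a single monomial, serves [field] as a rewriting rule. *)
have ht' : t ^+ 2 * rho ^+ 2 = 1 + 4 * rho + rho ^+ 2 - t ^+ 2.
  by rewrite -ht; ring.
rewrite /pi0 /pi1; by field: ht'; rewrite !lt0r_neq0 //; lra.
Qed.

Lemma eigform_mulPA phi t x : mass_one x -> eigform t (x *m PA phi) =
  (1 - 3 / 2 * phi) * eigform t x + 3 / 2 * phi * eigform t unif3.
Proof. by move=> h; rewrite /eigform !mulPAE // !mxE /=; field. Qed.

Lemma eigform_unif3 t : eigform t unif3 =
  (1 - rho) * (3 * (1 + rho) - (1 - rho) * t) / (6 * (1 + rho + rho ^+ 2)).
Proof.
have c := q_gt0; rewrite /eigform !mxE /= /pi0 /pi1.
by field; lra.
Qed.

Lemma eigform_unif3_sroot :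
  eigform sroot unif3 = (1 - rho) * (1 + rho) * (3 - gap) / (6 * (1 + rho + rho ^+ 2)).
Proof. by rewrite eigform_unif3 -gapE; congr (_ / _); ring. Qed.

Lemma eigform_unif3_srootN :
  eigform (- sroot) unif3 = (1 - rho) * (1 + rho) * (3 + gap) / (6 * (1 + rho + rho ^+ 2)).
Proof. by rewrite eigform_unif3 mulrN -gapE; congr (_ / _); ring. Qed.

Lemma eigform_unif3_gt0 : 0 < eigform sroot unif3.
Proof.
have /andP[r0 r1] := rho01; have c := q_gt0; have d1 := gap_lt1.
by rewrite eigform_unif3_sroot !(divr_gt0, mulr_gt0) //; lra.
Qed.

(** The two values differ only in the sign of [gap]. Together with [eigform_unif3_gt0] this puts the
    uniform vector strictly inside the cone. *)
Lemma eigform_unif3_lt : eigform sroot unif3 < eigform (- sroot) unif3.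
Proof.
have /andP[r0 r1] := rho01; have c := q_gt0; have d0 := gap_gt0.
have e : 0 < (1 - rho) * (1 + rho) by apply: mulr_gt0; lra.
rewrite eigform_unif3_sroot eigform_unif3_srootN ltr_pM2r ?ltr_pM2l //; last first.
  by rewrite invr_gt0; lra.
lra.
Qed.

End Spectral.

(** * Convergence for phi <= 2/3 *)

Section Dynamics.
Variables (R : realType) (rho : R).
Hypothesis rho01 : 0 < rho < 1.
Local Notation s := (sroot rho).
Implicit Types (phi : R) (x : 'rV[R]_3).

Lemma eigform_sub x :
  eigform rho s x - eigform rho (- s) x = 2 * s * (x 0 0 - pi0 rho).
Proof. by rewrite /eigform; ring. Qed.

Lemma greedyB_pi0 x : greedy rho x = GameB <-> x 0 0 < pi0 rho.
Proof. by rewrite /greedy; case: leP. Qed.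

Lemma greedyA_pi0 x : greedy rho x = GameA <-> pi0 rho <= x 0 0.
Proof. by rewrite /greedy; case: leP. Qed.

Lemma greedyB_eigform x :
  greedy rho x = GameB <-> eigform rho s x < eigform rho (- s) x.
Proof.
rewrite greedyB_pi0 -[_ s x < _]subr_lt0 eigform_sub.
by rewrite pmulr_rlt0 ?subr_lt0 // mulr_gt0 // sroot_gt0.
Qed.

Lemma F_mass_one phi x : mass_one x -> mass_one (F rho phi x).
Proof.
move=> h; rewrite /F /transition; case: greedy.
  exact: mulPA_mass_one.
exact: mulPB_mass_one.
Qed.

Lemma F_simplex phi x : 0 <= phi <= 1 -> simplex x -> simplex (F rho phi x).
Proof.
move=> p h; rewrite /F /transition; case: greedy.
  exact: mulPA_simplex.
exact: mulPB_simplex.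
Qed.

Lemma trajectoryS phi x n :
  trajectory rho phi x n.+1 = F rho phi (trajectory rho phi x n).
Proof. by []. Qed.

Lemma trajectoryD phi x m n : trajectory rho phi x (n + m) =
  trajectory rho phi (trajectory rho phi x m) n.
Proof. by rewrite /trajectory iterD. Qed.

Lemma trajectory_mass_one phi x n :
  mass_one x -> mass_one (trajectory rho phi x n).
Proof. by move=> h; elim: n => [//|n ih]; exact: F_mass_one. Qed.

Lemma trajectory_simplex phi x n :
  0 <= phi <= 1 -> simplex x -> simplex (trajectory rho phi x n).
Proof. by move=> p h; elim: n => [//|n ih]; exact: F_simplex. Qed.

Lemma eigform_FB phi x : mass_one x -> greedy rho x = GameB ->
  eigform rho s (F rho phi x) = eigval rho phi s * eigform rho s x /\
  eigform rho (- s) (F rho phi x) = eigval rho phi (- s) * eigform rho (- s) x.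
Proof.
move=> h gB; rewrite /F gB /=.
by split; apply: eigform_mulPB; rewrite ?sqrrN ?sroot_sq.
Qed.

Lemma eigform_FA phi x t : mass_one x -> greedy rho x = GameA ->
  eigform rho t (F rho phi x) =
  (1 - 3 / 2 * phi) * eigform rho t x
  + 3 / 2 * phi * eigform rho t (unif3 R).
Proof. by move=> h gA; rewrite /F gA /= eigform_mulPA. Qed.

(** * Descent to the invariant cone *)

Section SmallPhi.
Variable phi : R.
Hypothesis phi_small : 0 < phi <= 2 / 3.

(** The eigenvalues are a - d and a + d with a = 1 - 3 phi / 2 >= 0 and d = phi [gap] / 2 > 0. *)
Lemma eigval_small : [/\ `|eigval rho phi s| <= eigval rho phi (- s),
  0 < eigval rho phi (- s) & eigval rho phi (- s) < 1].
Proof.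
have /andP[p0 p1] := phi_small.
have d0 := gap_gt0 rho01; have d1 := gap_lt1 rho01.
have pd : phi * gap rho < phi by rewrite -[ltRHS]mulr1 ltr_pM2l.
have pd0 : 0 < phi * gap rho by rewrite mulr_gt0.
rewrite eigval_sroot eigval_srootN; split; last 2 first.
- lra.
- lra.
by rewrite ler_norml; apply/andP; split; lra.
Qed.

(* Negative exactly on the cone |eigform s| < eigform (-s), which lies in the
   region of game B and is invariant under both games. *)
Definition excess x : R := `|eigform rho s x| - eigform rho (- s) x.

Lemma excess_lt0_greedy x : excess x < 0 -> greedy rho x = GameB.
Proof.
rewrite /excess subr_lt0 => h; apply/greedyB_eigform.
exact: le_lt_trans (ler_norm _) h.
Qed.

Lemma excess_lt0_F x : mass_one x -> excess x < 0 -> excess (F rho phi x) < 0.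
Proof.
move=> h w; have [e1 e2] := eigform_FB phi h (excess_lt0_greedy w).
have [l1 l0 _] := eigval_small.
move: w; rewrite /excess e1 e2 !subr_lt0 normrM => w.
apply: le_lt_trans (_ : eigval rho phi (- s) * `|eigform rho s x| < _).
  by rewrite ler_wpM2r.
by rewrite ltr_pM2l.
Qed.

Lemma excess_lt0_eventually_B x :
  mass_one x -> excess x < 0 -> forall n, greedy rho (trajectory rho phi x n) = GameB.
Proof.
move=> h w n; apply: excess_lt0_greedy.
elim: n => [//|n ih].
by rewrite trajectoryS excess_lt0_F //; exact: trajectory_mass_one.
Qed.

(** As |lam(s)| <= lam(-s), the new excess is at most lam(-s) times the old one, and lam(-s) < 1. *)
Lemma excess_FB x : mass_one x -> greedy rho x = GameB -> 0 <= excess x ->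
  excess (F rho phi x) <= excess x.
Proof.
move=> h gB w; have [l1 l0 l2] := eigval_small.
have [e1 e2] := eigform_FB phi h gB; rewrite {1}/excess e1 e2.
move: w; rewrite normrM /excess.
have := normr_ge0 (eigform rho s x).
have := normr_ge0 (eigval rho phi s).
set a := `|eigform _ _ _|; set m := eigform _ _ _.
set b := `|_|; set l := eigval _ _ _ => b0 a0 w.
have [m0|m0] := leP 0 m; first by rewrite -/b -/l in l1 l0 l2; nra.
rewrite -/b -/l in l1 l0 l2; nra.
Qed.

(** The excess is convex, so with k = 1 - 3 phi / 2 in [0, 1) the new value is at most k times the
    old one plus 1 - k times the negative excess of the uniform vector. *)
Lemma excess_FA x : mass_one x -> greedy rho x = GameA ->
  0 <= excess x -> excess (F rho phi x) <= excess x
  - 3 / 2 * phi * (eigform rho (- s) (unif3 R) - eigform rho s (unif3 R)).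
Proof.
move=> h gA w; have /andP[p0 p1] := phi_small.
rewrite {1}/excess !eigform_FA //; have u0 := eigform_unif3_gt0 rho01.
have k0 : 0 <= 1 - 3 / 2 * phi by lra.
have := ler_normD ((1 - 3 / 2 * phi) * eigform rho s x)
                  (3 / 2 * phi * eigform rho s (unif3 R)).
have k1 : 0 <= 3 / 2 * phi * eigform rho s (unif3 R).
  by rewrite mulr_ge0 ?ltW // mulr_gt0 //; lra.
rewrite (normrM (1 - _)) (ger0_norm k0) (ger0_norm k1).
move: w; rewrite /excess.
set a := `|eigform _ _ _|; set m := eigform _ _ x.
set u := eigform _ _ (unif3 R); set v := eigform _ _ (unif3 R).
set z := `|_ + _| => w hz.
have : phi * (a - m) >= 0 by rewrite mulr_ge0 // ltW.
lra.
Qed.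

Lemma eventually_B_small x : mass_one x -> eventually_B rho phi x.
Proof.
move=> h; apply: contrapT => nev.
have /andP[p0 p1] := phi_small.
pose c := 3 / 2 * phi * (eigform rho (- s) (unif3 R) - eigform rho s (unif3 R)).
have c0 : 0 < c.
  by rewrite /c !mulr_gt0 ?subr_gt0 ?eigform_unif3_lt //; lra.
pose y n := trajectory rho phi x n.
have hy n : mass_one (y n) by exact: trajectory_mass_one.
have w0 n : 0 <= excess (y n).
  rewrite leNgt; apply/negP => wn; apply: nev; exists n => k nk.
  by rewrite -(subnK nk) trajectoryD excess_lt0_eventually_B.
have wS n : excess (y n.+1) <= excess (y n).
  case gn : (greedy rho (y n)); rewrite /y trajectoryS; last exact: excess_FB.
  apply: le_trans (excess_FA _ gn _) _ => //.
  by rewrite lerBlDr lerDl ltW.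
have wle m n : (m <= n)%N -> excess (y n) <= excess (y m).
  by move/subnK <-; elim: (n - m)%N => [//|k ih]; apply: le_trans (wS _) ih.
have hA n : exists2 k, (n <= k)%N & greedy rho (y k) = GameA.
  apply: contrapT => hn; apply: nev; exists n => k nk.
  by case gk : greedy => //; case: hn; exists k.
(* Game A recurs forever, and each time it costs at least [c]; more than [excess x / c] occurrences
   make the excess negative. *)
have hk k : exists n, excess (y n) <= excess x - k%:R * c.
  elim: k => [|k [n ih]]; first by exists 0%N; rewrite mul0r subr0.
  have [j nj gj] := hA n; exists j.+1; rewrite /y trajectoryS.
  apply: le_trans (excess_FA _ gj _) _ => //.
  rewrite -/c -natr1; have := wle _ _ nj; lra.
have [n hn] := hk (Num.Def.archi_bound (excess x / c)).
have : excess x / c < (Num.Def.archi_bound (excess x / c))%:R.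
  by apply: archi_boundP; rewrite divr_ge0 ?(w0 0%N) ?ltW.
rewrite ltr_pdivrMr // => hlt; have := w0 n; lra.
Qed.

End SmallPhi.

End Dynamics.

(** * Convergence to the stationary distribution of P_B *)

Section Convergence.
Variables (R : realType) (rho : R).
Hypothesis rho01 : 0 < rho < 1.
Local Notation s := (sroot rho).
Implicit Types (x : 'rV[R]_3).

Lemma norm_row3_le x (c : R) : 0 <= c ->
  `|x 0 0| <= c -> `|x 0 1| <= c -> `|x 0 2| <= c -> `|x| <= c.
Proof.
move=> c0 h0 h1 h2; rewrite /Num.norm /= mx_normrE.
apply/bigmax_leP; split=> // -[i j] _ /=; rewrite ord1.
by move: j; apply: I3_ind.
Qed.

Lemma norm_row_ge x j : `|x 0 j| <= `|x|.
Proof.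
rewrite [leRHS]/Num.norm /= mx_normrE.
exact: (le_bigmax _ (fun ij : 'I_1 * 'I_3 => `|x ij.1 ij.2|) (0, j)).
Qed.

Lemma mass_one_subE x : mass_one x -> x 0 2 - pi2 rho =
  - (x 0 0 - pi0 rho) - (x 0 1 - pi1 rho).
Proof.
have c := q_gt0 rho01; move=> /mass_oneE ->; rewrite /pi0 /pi1 /pi2.
by field; lra.
Qed.

(** The constant 5 is the sum of the coefficient bounds |1 + t| <= 3 and 2. *)
Lemma eigform_le_norm t x : `|t| <= 2 ->
  `|eigform rho t x| <= 5 * `|x - piB rho|.
Proof.
move=> t2.
have h0 := norm_row_ge (x - piB rho) 0.
have h1 := norm_row_ge (x - piB rho) 1.
rewrite !mxE /= in h0 h1; rewrite /eigform.
apply: le_trans (ler_normD _ _) _; rewrite !normrM (ger0_norm (_ : 0 <= 2)) //.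
have : `|1 + t| <= 3 by apply: le_trans (ler_normD _ _) _; rewrite normr1; lra.
move: h0 h1; set a := `|_ - pi0 _|; set b := `|_ - pi1 _|.
have : 0 <= a by exact: normr_ge0.
move: `|1 + t| => z; nra.
Qed.

(** The two forms are coordinates on the plane of mass one: their difference gives x_0 (as s > 1),
    then the form at s gives x_1 (as s < 2), and the mass gives x_2, with errors c, 2 c and 3 c. *)
Lemma norm_le_eigform x (c : R) : mass_one x -> `|eigform rho s x| <= c ->
  `|eigform rho (- s) x| <= c -> `|x - piB rho| <= 3 * c.
Proof.
move=> h hl hm.
have s1 := sroot_gt1 rho01; have s2 := sroot_lt2 rho01.
have c0 : 0 <= c by exact: le_trans hl.
have ha : `|x 0 0 - pi0 rho| <= c.
  have : `|2 * s * (x 0 0 - pi0 rho)| <= 2 * c.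
    rewrite -eigform_sub; apply: le_trans (ler_normB _ _) _; lra.
  rewrite normrM (gtr0_norm (_ : 0 < 2 * s)); last lra.
  have := normr_ge0 (x 0 0 - pi0 rho); move: `|_| => a; nra.
have hb : `|x 0 1 - pi1 rho| <= 2 * c.
  have : `|2 * (x 0 1 - pi1 rho)| <= c + 3 * c.
    have -> : 2 * (x 0 1 - pi1 rho) =
        eigform rho s x - (1 + s) * (x 0 0 - pi0 rho).
      by rewrite /eigform; ring.
    apply: le_trans (ler_normB _ _) _; apply: lerD => //.
    rewrite normrM ler_pM // gtr0_norm; lra.
  rewrite normrM (gtr0_norm (_ : 0 < 2)); lra.
have hc : `|x 0 2 - pi2 rho| <= 3 * c.
  rewrite mass_one_subE //; apply: le_trans (ler_normB _ _) _.
  rewrite normrN; lra.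
by apply: norm_row3_le; rewrite ?mxE /=; lra.
Qed.

Variable phi : R.
Hypothesis phi_small : 0 < phi <= 2 / 3.
Local Notation G := (fun x : 'rV[R]_3 => x *m PB rho phi).

Lemma iter_mulPB_mass_one x n : mass_one x -> mass_one (iter n G x).
Proof. by move=> h; elim: n => [//|n ih]; exact: mulPB_mass_one. Qed.

Lemma eigform_iter_mulPB t x n : t ^+ 2 * (1 + rho ^+ 2) = 1 + 4 * rho + rho ^+ 2 ->
  mass_one x -> eigform rho t (iter n G x) = eigval rho phi t ^+ n * eigform rho t x.
Proof.
move=> ht h; elim: n => [|n ih]; first by rewrite mul1r.
rewrite iterS eigform_mulPB //; last exact: iter_mulPB_mass_one.
by rewrite ih exprS mulrA.
Qed.

(** Passing to the eigenforms costs 5 and coming back costs 3; lam(-s) dominates both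
    eigenvalues. *)
Lemma iter_mulPB_dist x n : mass_one x -> `|iter n G x - piB rho| <=
  15 * (eigval rho phi (- s) ^+ n * `|x - piB rho|).
Proof.
move=> h; have [l1 l0 _] := eigval_small rho01 phi_small.
have s1 := sroot_gt1 rho01; have s2 := sroot_lt2 rho01.
have -> : 15 * (eigval rho phi (- s) ^+ n * `|x - piB rho|) =
  3 * (eigval rho phi (- s) ^+ n * (5 * `|x - piB rho|)) by ring.
apply: norm_le_eigform; first exact: iter_mulPB_mass_one.
- rewrite eigform_iter_mulPB ?sroot_sq // normrM normrX ler_pM //.
    by apply: lerXn2r; rewrite ?nnegrE // ltW.
  by rewrite eigform_le_norm // ger0_norm; lra.
- rewrite eigform_iter_mulPB ?sqrrN ?sroot_sq // normrM normrX gtr0_norm //.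
  by rewrite ler_pM2l ?exprn_gt0 // eigform_le_norm // normrN ger0_norm; lra.
Qed.

Lemma iter_mulPB_cvg x : mass_one x -> iter n G x @[n --> \oo] --> piB rho.
Proof.
move=> h; have [_ l0 l1] := eigval_small rho01 phi_small.
apply/cvgrPdist_lt => e e0; near=> n.
rewrite distrC; apply: le_lt_trans (iter_mulPB_dist n h) _.
rewrite mulrCA; apply: le_lt_trans (ler_norm _) _.
near: n; apply: cvgr0_norm_lt e0.
rewrite -[X in _ --> X](mul0r (15 * `|x - piB rho|)).
apply: cvgMr_tmp.
by apply: cvg_expr; rewrite gtr0_norm.
Unshelve. all: by end_near. Qed.

Lemma stationaryP y : stationary (PB rho phi) y <-> y = piB rho.
Proof.
split=> [[/simplex_mass_one h e]|->]; last first.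
  by split; [exact: simplex_piB | exact: piB_mulPB].
(* Uniqueness: the orbit of a stationary vector is constant and converges to [piB]. *)
have en n : iter n G y = y by elim: n => [//|n ih]; rewrite iterS ih.
have := iter_mulPB_cvg h; under eq_fun do rewrite en.
by move/cvg_lim => <- //; rewrite lim_cst.
Qed.

Lemma mulPB_stable : globally_asymptotically_stable (@simplex R) G (piB rho).
Proof.
have [_ l0 l1] := eigval_small rho01 phi_small.
split.
- by split; [exact: simplex_piB | exact: piB_mulPB].
- move=> e e0; exists (e / 15); first by rewrite divr_gt0.
  move=> x /simplex_mass_one h hx n.
  apply: le_lt_trans (iter_mulPB_dist n h) _.
  rewrite mulrC -ltr_pdivlMr //; apply: le_lt_trans hx.
  by rewrite ler_piMl // exprn_ile1 ?ltW.
- by move=> x /simplex_mass_one; exact: iter_mulPB_cvg.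
Qed.

Lemma trajectory_cvg x : mass_one x ->
  trajectory rho phi x n @[n --> \oo] --> piB rho.
Proof.
move=> h; have [N hN] := eventually_B_small rho01 phi_small h.
rewrite -(cvg_shiftn N).
have -> : (fun n => trajectory rho phi x (n + N)) =
    (fun n => iter n G (trajectory rho phi x N)).
  apply/funext => n; elim: n => [//|n ih].
  by rewrite addSn trajectoryS iterS -ih /F hN // leq_addl.
by apply: iter_mulPB_cvg; exact: trajectory_mass_one.
Qed.

End Convergence.

(** * Trajectories choosing game B forever for phi > 2/3 *)

Section LargePhi.
Variables (R : realType) (rho : R).
Hypothesis rho01 : 0 < rho < 1.
Local Notation s := (sroot rho).
Implicit Types (x : 'rV[R]_3).
Variable phi : R.
Hypothesis phi_large : 2 / 3 < phi < 1.

(** Now a = 1 - 3 phi / 2 < 0, so among a - d and a + d with d = phi [gap] / 2 the former has the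
    larger modulus; it exceeds -1 because phi and [gap] are below 1. *)
Lemma eigval_large :
  [/\ eigval rho phi s < 0, - 1 < eigval rho phi s &
      `|eigval rho phi (- s)| < - eigval rho phi s].
Proof.
have /andP[p0 p1] := phi_large.
have d0 := gap_gt0 rho01; have d1 := gap_lt1 rho01.
have pd : phi * gap rho < phi by rewrite -[ltRHS]mulr1 ltr_pM2l //; lra.
have pd0 : 0 < phi * gap rho by rewrite mulr_gt0 //; lra.
rewrite eigval_sroot eigval_srootN ltr_norml; split; lra.
Qed.

Lemma eigform_trajectoryB x n : mass_one x ->
  (forall n, greedy rho (trajectory rho phi x n) = GameB) ->
  eigform rho s (trajectory rho phi x n) =
    eigval rho phi s ^+ n * eigform rho s x /\
  eigform rho (- s) (trajectory rho phi x n) =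
    eigval rho phi (- s) ^+ n * eigform rho (- s) x.
Proof.
move=> h hB; elim: n => [|n [ih1 ih2]]; first by rewrite !mul1r.
have [e1 e2] := eigform_FB rho01 phi (trajectory_mass_one rho01 phi n h) (hB n).
by rewrite trajectoryS e1 e2 ih1 ih2 !exprS !mulrA.
Qed.

(* The eigenvalue at s is negative and dominates the one at -s in absolute
   value, so a nonzero component along it would make eigform s - eigform (-s)
   change sign forever. *)
Lemma always_B x : mass_one x ->
  (forall n, greedy rho (trajectory rho phi x n) = GameB) ->
  eigform rho s x = 0 /\ 0 < eigval rho phi (- s).
Proof.
move=> h hB; have [l0 _ lm] := eigval_large.
have hn n : eigval rho phi s ^+ n * eigform rho s x <
    eigval rho phi (- s) ^+ n * eigform rho (- s) x.
  have [<- <-] := eigform_trajectoryB n h hB.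
  by apply/(greedyB_eigform rho01).
have L0 : eigform rho s x = 0.
  apply/eqP; apply: contrapT => /negP Ln.
  pose r := `|eigval rho phi (- s)| / - eigval rho phi s.
  have r1 : `|r| < 1.
    by rewrite normrM normfV normr_id (@gtr0_norm _ (- _)) ?oppr_gt0 //
               ltr_pdivrMr ?oppr_gt0 // mul1r.
  (* Adding 1 keeps the denominator positive even if [eigform rho (- s) x] is zero. *)
  have c : 0 < `|eigform rho s x| / (1 + `|eigform rho (- s) x|).
    by rewrite divr_gt0 ?normr_gt0 // ltr_pwDl.
  have [N _ /(_ _) hN] := cvgr0_norm_lt _ (cvg_expr r1) _ c.
  have key n : (N <= n)%N -> `|eigval rho phi (- s)| ^+ n * `|eigform rho (- s) x| <
      (- eigval rho phi s) ^+ n * `|eigform rho s x|.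
    move=> /hN /=; rewrite /r normrX ger0_norm; last first.
      by rewrite divr_ge0 // oppr_ge0 ltW.
    rewrite ltr_pdivlMr; last by rewrite ltr_pwDl.
    rewrite expr_div_n mulrAC ltr_pdivrMr ?exprn_gt0 ?oppr_gt0 //.
    rewrite [ltRHS]mulrC; apply: le_lt_trans.
    by rewrite ler_wpM2l ?exprn_ge0 // lerDr.
  have dom n : (N <= n)%N -> eigval rho phi (- s) ^+ n * eigform rho (- s) x <
      (- eigval rho phi s) ^+ n * `|eigform rho s x|.
    move=> /key; apply: le_lt_trans.
    by rewrite -normrX -normrM ler_norm.
  (* Past [N] both parities occur; the one that makes lam(s)^n times the form at s positive
     contradicts [hn]. *)
  have N2 : (N <= N.*2)%N by rewrite -addnn leq_addr.
  have [Lp|Lp] := leP 0 (eigform rho s x).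
    have := lt_trans (hn N.*2) (dom _ N2).
    by rewrite ger0_norm // exprNn -signr_odd odd_double mul1r ltxx.
  have := lt_trans (hn N.*2.+1) (dom _ (leqW N2)).
  rewrite ltr0_norm // exprNn -signr_odd /= odd_double /= expr1.
  by rewrite mulN1r mulrNN ltxx.
split=> //; have := hn 0%N; have := hn 1%N.
rewrite L0 !mulr0 expr1 mul1r => h1 h0.
by rewrite -(pmulr_lgt0 _ h0).
Qed.

Lemma lt_phi2 : 0 < eigval rho phi (- s) -> phi < phi2 rho.
Proof.
have d1 := gap_lt1 rho01; rewrite eigval_srootN phi2E // => l0.
rewrite ltr_pdivlMr; lra.
Qed.

(* The value of eigform s at the states which game A sends to the line
   eigform s = 0. *)
Definition exitA : R := 3 * phi / (3 * phi - 2) * eigform rho s (unif3 R).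

Lemma exitA_FA x : mass_one x -> greedy rho x = GameA -> eigform rho s x =
  exitA - eigform rho s (F rho phi x) / (3 / 2 * phi - 1).
Proof.
move=> h gA; have /andP[p0 p1] := phi_large.
by rewrite (eigform_FA _ _ h gA) /exitA; clear gA; field; lra.
Qed.

(** The homothety now has negative ratio and sends x_0 >= pi_0 > 1/3 below 1/3. *)
Lemma greedy_FA x : simplex x -> greedy rho x = GameA ->
  greedy rho (F rho phi x) = GameB.
Proof.
move=> /simplex_mass_one h gA; have /andP[p0 p1] := phi_large.
have p3 := pi0_gt rho01; apply/greedyB_pi0; rewrite /F gA /= mulPAE //.
move/greedyA_pi0: gA => gA; nra.
Qed.

(** * Excluded predecessors *)

Section Preimages.
Hypothesis eigval_gt0 : 0 < eigval rho phi (- s).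

(** The quotient of the two sides is phi d (3 - d) / (2 (3 phi - 2)) with d = [gap]. From lam(-s) >
    0 comes 3 phi - 2 < phi d, and d < 1 gives 2 < 3 - d. *)
Lemma exitA_lb : (1 + rho) ^+ 2 < (1 + rho + rho ^+ 2) * exitA * s.
Proof.
have /andP[p0 p1] := phi_large; have /andP[r0 r1] := rho01.
have c := q_gt0 rho01; have d0 := gap_gt0 rho01; have d1 := gap_lt1 rho01.
have := eigval_gt0; rewrite eigval_srootN => ll.
have u : (1 + rho + rho ^+ 2) * eigform rho s (unif3 R) * s * 6 =
    (1 + rho) ^+ 2 * (gap rho * (3 - gap rho)).
  rewrite eigform_unif3_sroot //.
  transitivity ((1 - rho) * s * (1 + rho) * (3 - gap rho)); first by field; lra.
  by rewrite -gapE //; ring.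
have e0 : 0 < 3 * phi - 2 by lra.
have -> : (1 + rho + rho ^+ 2) * exitA * s =
   (1 + rho) ^+ 2 * (gap rho * (3 - gap rho) * phi / (2 * (3 * phi - 2))).
  apply: (@mulIf _ 6) => /=; first by lra.
  rewrite /exitA; transitivity ((1 + rho + rho ^+ 2) * eigform rho s (unif3 R) * s * 6 *
    (3 * phi / (3 * phi - 2))); first by field; lra.
  by rewrite u; field; lra.
rewrite -[ltLHS]mulr1 ltr_pM2l; last by rewrite exprn_gt0 //; lra.
rewrite ltr_pdivlMr; last lra.
have : phi * gap rho * (1 - gap rho) > 0 by apply: mulr_gt0; [apply: mulr_gt0|]; lra.
nra.
Qed.

Lemma exitA_gt0 : 0 < exitA.
Proof.
have /andP[p0 p1] := phi_large.
by rewrite /exitA mulr_gt0 ?eigform_unif3_gt0 // divr_gt0 //; lra.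
Qed.

(** Since -1 < lam(s) < 0, the form at s is at most -[exitA] after the move, hence at least 3
    [exitA] before it; this exceeds its maximum on the simplex. *)
Lemma not_A_BA x : simplex x -> greedy rho x = GameA ->
  eigval rho phi s * eigform rho s (F rho phi x) = exitA -> False.
Proof.
move=> hs gA; have h := simplex_mass_one hs; have eA := exitA_FA h gA; clear gA.
have /andP[p0 p1] := phi_large; have /andP[r0 r1] := rho01.
have c := q_gt0 rho01; have lb := exitA_lb; have x0 := exitA_gt0.
have s1 := sroot_gt1 rho01; have s2 := sroot_lt2 rho01.
have d1 := gap_lt1 rho01; have d0 := gap_gt0 rho01.
have [l0 l1 _] := eigval_large => eB.
have l2 := eigval_gt0; rewrite eigval_srootN in l2.
have e2 : 3 / 2 * phi - 1 < 1 / 2.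
  have : phi * gap rho < phi by rewrite -[ltRHS]mulr1 ltr_pM2l //; lra.
  lra.
have b1 : exitA <= - eigform rho s (F rho phi x).
  have : eigform rho s (F rho phi x) < 0 by rewrite -(nmulr_rgt0 _ l0) eB.
  rewrite -eB; nra.
have b2 : exitA * 3 <= eigform rho s x.
  rewrite eA -mulNr; have : 2 * exitA <= - eigform rho s (F rho phi x) / (3 / 2 * phi - 1).
    rewrite ler_pdivlMr; last lra.
    nra.
  lra.
have [hx h1] := hs; have [a0 [a1 a2]] := (hx 0, (hx 1, hx 2)).
have b3 : (1 + rho + rho ^+ 2) * (eigform rho s x * s) <= 3 * (1 + rho) ^+ 2.
  have -> : eigform rho s x = (1 + s) * x 0 0 + 2 * x 0 1
     - ((1 + s) * pi0 rho + 2 * pi1 rho) by rewrite /eigform; ring.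
  (* The maximum is at the vertex x_0 = 1, because 1 + s > 2. *)
  have m : (1 + s) * x 0 0 + 2 * x 0 1 <= 1 + s.
    have : (1 + s) * (x 0 0 + x 0 1) <= 1 + s.
      rewrite -[leRHS]mulr1 ler_pM2l; lra.
    nra.
  have E : (1 + rho + rho ^+ 2) * (1 + s - ((1 + s) * pi0 rho + 2 * pi1 rho)) * 2
     = (1 + s) * (1 + rho) ^+ 2 - 2 * rho * (1 + rho).
    by rewrite /pi0 /pi1; field; lra.
  have M : (1 + rho + rho ^+ 2) * (((1 + s) * x 0 0 + 2 * x 0 1
     - ((1 + s) * pi0 rho + 2 * pi1 rho))) * 2 <= (1 + s) * (1 + rho) ^+ 2.
    apply: le_trans (_ : (1 + s) * (1 + rho) ^+ 2 - 2 * rho * (1 + rho) <= _); last first.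
      rewrite gerBl; apply: mulr_ge0; lra.
    rewrite -E ler_pM2r // ler_pM2l //; lra.
  have : (1 + s) * s * (1 + rho) ^+ 2 <= 6 * (1 + rho) ^+ 2.
    by rewrite ler_wpM2r ?sqr_ge0 //; nra.
  nra.
have : (1 + rho + rho ^+ 2) * (exitA * 3 * s) <= (1 + rho + rho ^+ 2) * (eigform rho s x * s).
  by rewrite ler_pM2l // ler_pM2r //; lra.
nra.
Qed.

(** Here lam(s)^2 < 1 makes the form at least [exitA] after the move, hence at most -[exitA] before
    it; but x_0 >= pi_0 and x_1 >= 0 bound it below by -2 pi_1. *)
Lemma not_A_BBA x : simplex x -> greedy rho x = GameA ->
  eigval rho phi s ^+ 2 * eigform rho s (F rho phi x) = exitA -> False.
Proof.
move=> hs gA; have h := simplex_mass_one hs; have eA := exitA_FA h gA.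
have a0 := (greedyA_pi0 rho x).1 gA; clear gA.
have /andP[p0 p1] := phi_large; have /andP[r0 r1] := rho01.
have c := q_gt0 rho01; have lb := exitA_lb; have x0 := exitA_gt0.
have s1 := sroot_gt1 rho01; have s2 := sroot_lt2 rho01.
have d1 := gap_lt1 rho01; have d0 := gap_gt0 rho01.
have [l0 l1 _] := eigval_large => eB.
have l2 := eigval_gt0; rewrite eigval_srootN in l2.
have e2 : 3 / 2 * phi - 1 < 1 / 2.
  have : phi * gap rho < phi by rewrite -[ltRHS]mulr1 ltr_pM2l //; lra.
  lra.
have b1 : exitA <= eigform rho s (F rho phi x).
  have q0 : 0 < eigval rho phi s ^+ 2 by rewrite exprn_even_gt0 //= ltr0_neq0.
  have q1 : eigval rho phi s ^+ 2 < 1 by nra.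
  by rewrite -eB; nra.
have b2 : eigform rho s x <= - exitA.
  rewrite eA; have : 2 * exitA <= eigform rho s (F rho phi x) / (3 / 2 * phi - 1).
    rewrite ler_pdivlMr; last lra.
    nra.
  lra.
have [hx h1] := hs; have a1 := hx 1.
have b3 : - (2 * pi1 rho) <= eigform rho s x.
  have : 0 <= (1 + s) * (x 0 0 - pi0 rho) by rewrite mulr_ge0 //; lra.
  rewrite /eigform; lra.
have E : (1 + rho + rho ^+ 2) * (2 * pi1 rho) = rho * (1 + rho).
  by rewrite /pi1; field; lra.
have : (1 + rho + rho ^+ 2) * exitA <= (1 + rho + rho ^+ 2) * (2 * pi1 rho).
  rewrite ler_pM2l //; lra.
rewrite E => b4.
have : (1 + rho + rho ^+ 2) * exitA * s <= rho * (1 + rho) * s.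
  rewrite ler_pM2r //; lra.
nra.
Qed.

(** Since |lam(s)|^3 <= 1, the form at s is at most -[exitA]. Game B being chosen again at the next
    turn forces its opposite below the form at -s, whence [exitA] < s pi_0, against [exitA_lb]. *)
Lemma not_B_BBA x : simplex x -> greedy rho x = GameB ->
  greedy rho (F rho phi x) = GameB ->
  eigval rho phi s ^+ 2 * eigform rho s (F rho phi x) = exitA -> False.
Proof.
move=> hs gB gB' eB; have h := simplex_mass_one hs.
have /andP[r0 r1] := rho01.
have c := q_gt0 rho01; have lb := exitA_lb; have x0 := exitA_gt0.
have s1 := sroot_gt1 rho01; have s2 := sroot_sq rho01.
have [l0 l1 l2] := eigval_large; have l3 := eigval_gt0.
have [e1 e2] := eigform_FB rho01 phi h gB.
move/(greedyB_eigform rho01): gB'; rewrite e1 e2 => b1; clear gB.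
rewrite gtr0_norm // in l2.
have q0 : (- eigval rho phi s) ^+ 3 <= 1 by rewrite exprn_ile1 //; lra.
have b2 : exitA <= - eigform rho s x.
  have q1 : 0 < (- eigval rho phi s) ^+ 3 by rewrite exprn_gt0 //; lra.
  have E : (- eigval rho phi s) ^+ 3 * - eigform rho s x = exitA.
    by rewrite -eB e1; ring.
  rewrite -E ger_pMl //; rewrite -(pmulr_rgt0 _ q1) E //.
have b3 : - eigform rho s x < eigform rho (- s) x.
  nra.
have E : eigform rho s x = eigform rho (- s) x + 2 * s * (x 0 0 - pi0 rho).
  by rewrite -eigform_sub; ring.
have [/(_ 0) a0 _] := hs.
have b4 : exitA < s * pi0 rho.
  have : 0 <= s * x 0 0 by rewrite mulr_ge0 //; lra.
  nra.
have b5 : (1 + rho + rho ^+ 2) * exitA * s < (1 + rho + rho ^+ 2) * (s * pi0 rho) * s.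
  rewrite ltr_pM2r ?ltr_pM2l //; lra.
have E2 : (1 + rho + rho ^+ 2) * (s * pi0 rho) * s * 2 = s ^+ 2 * (1 + rho ^+ 2).
  by rewrite /pi0; field; lra.
rewrite s2 in E2.
have := sqr_ge0 rho; nra.
Qed.

End Preimages.

End LargePhi.

(** * The regions as successive preimages of the line [eigform s] = 0 *)

Section Regions.
Variables (R : realType) (rho : R).
Hypothesis rho01 : 0 < rho < 1.
Local Notation s := (sroot rho).
Implicit Types (x : 'rV[R]_3).
Variable phi : R.
Hypothesis phi_large : 2 / 3 < phi < 1.
Local Notation lam := (eigval rho phi s).
Local Notation c := ((1 + s) * pi0 rho + 2 * pi1 rho).

Let Sq := Sroot_sq rho01.

Lemma g2E : g2 rho phi = - (2 * (1 + rho) * (1 + rho ^+ 2) * lam).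
Proof.
have /andP[r0 r1] := rho01; have b := onesq_gt0 rho.
by rewrite /g2 /eigval /sroot; field; rewrite !lt0r_neq0 //; lra.
Qed.

Lemma h2E : h2 rho phi = - (2 * (1 + rho) ^+ 2 * (1 + rho ^+ 2) * lam ^+ 2).
Proof.
have /andP[r0 r1] := rho01; have b := onesq_gt0 rho.
rewrite /h2 /eigval /sroot.
by field: Sq; rewrite !lt0r_neq0 //; lra.
Qed.

(** With [g2E], the intercept of [g] becomes ([exitA] / lam + c) / 2; [h1E] and [h2E] do the same
    for [h] with lam^2. *)
Lemma g1E : g1 rho phi =
  - ((1 + rho) * (1 + rho ^+ 2) * (3 * phi - 2) * (exitA rho phi + c * lam)).
Proof.
have /andP[r0 r1] := rho01; have b := onesq_gt0 rho; have q := q_gt0 rho01.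
have /andP[p0 p1] := phi_large.
rewrite /g1 /exitA eigform_unif3 // /eigval /sroot /pi0 /pi1.
by field: Sq; rewrite !lt0r_neq0 //; lra.
Qed.

Lemma h1E : h1 rho phi = - ((1 + rho) ^+ 2 * (1 + rho ^+ 2) * (3 * phi - 2)
  * (exitA rho phi + c * lam ^+ 2)).
Proof.
have /andP[r0 r1] := rho01; have b := onesq_gt0 rho; have q := q_gt0 rho01.
have /andP[p0 p1] := phi_large.
rewrite /h1 /exitA eigform_unif3 // /eigval /sroot /pi0 /pi1.
by field: Sq; rewrite !lt0r_neq0 //; lra.
Qed.

Lemma eigform_solve x : x 0 1 =
  - (1 / 2) * (1 + s) * x 0 0 + (eigform rho s x + c) / 2.
Proof. by rewrite /eigform; field. Qed.

Lemma exitA_f x : eigform rho s x = exitA rho phi -> x 0 1 = f rho phi (x 0 0).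
Proof.
have /andP[r0 r1] := rho01; have b := onesq_gt0 rho; have q := q_gt0 rho01.
have /andP[p0 p1] := phi_large.
move=> e; rewrite eigform_solve e /f; congr (_ + _).
rewrite /exitA eigform_unif3 // /sroot /pi0 /pi1.
by field: Sq; rewrite !lt0r_neq0 //; lra.
Qed.

Lemma exitA_g x : lam * eigform rho s x = exitA rho phi -> x 0 1 = g rho phi (x 0 0).
Proof.
have /andP[r0 r1] := rho01; have b := onesq_gt0 rho.
have /andP[p0 p1] := phi_large.
have [l0 _ _] := eigval_large rho01 phi_large.
move=> e; rewrite eigform_solve /g; congr (_ + _).
rewrite g1E g2E -e; field.
by rewrite ltr0_neq0 // !lt0r_neq0 //; lra.
Qed.

Lemma exitA_h x : lam ^+ 2 * eigform rho s x = exitA rho phi ->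
  x 0 1 = h rho phi (x 0 0).
Proof.
have /andP[r0 r1] := rho01; have b := onesq_gt0 rho.
have /andP[p0 p1] := phi_large.
have [l0 _ _] := eigval_large rho01 phi_large.
move=> e; rewrite eigform_solve /h; congr (_ + _).
rewrite h1E h2E -e; field.
by rewrite ltr0_neq0 // !lt0r_neq0 //; lra.
Qed.

Lemma simplexA_greedy x : simplex x -> greedy rho x = GameA -> simplexA rho x.
Proof. by move=> h /greedyA_pi0. Qed.

Lemma simplexB_greedy x : simplex x -> greedy rho x = GameB -> simplexB rho x.
Proof. by move=> h /greedyB_pi0; rewrite ltNge => /negP gB; split => // -[]. Qed.

Lemma eventually_B_large x : simplex x -> eventually_B rho phi x ->
  phi < phi2 rho /\ [\/ R1 rho x, R2 rho phi x, R3 rho phi x | R4 rho phi x].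
Proof.
move=> hx [N0 hN0].
have phi01 : 0 <= phi <= 1 by have /andP[p0 p1] := phi_large; apply/andP; lra.
pose y n := trajectory rho phi x n.
have hy n : simplex (y n) by exact: trajectory_simplex.
have my n := simplex_mass_one (hy n).
have yS n : y n.+1 = F rho phi (y n) by [].
(* The least N in [tail] is sought; N = 0, 1, 2, 3 give R1, R2, R3, R4, and N >= 4 is impossible. *)
pose tail N := `[< forall n, (N <= n)%N -> greedy rho (y n) = GameB >].
have tail_ex : exists N, tail N by exists N0; apply/asboolP.
have [N /asboolP tN minN] := ex_minnP tail_ex.
have [L0 l0] : eigform rho s (y N) = 0 /\ 0 < eigval rho phi (- s).
  apply: (always_B rho01 phi_large (my N)) => n.
  by rewrite -trajectoryD; apply: tN; rewrite leq_addl.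
split; first exact: lt_phi2.
have B_or_A n : greedy rho (y n) = GameB \/ greedy rho (y n) = GameA.
  by case: greedy; [right | left].
have FA n : greedy rho (y n) = GameA -> greedy rho (y n.+1) = GameB.
  by move=> gA; rewrite yS; exact: greedy_FA.
have FB n : greedy rho (y n) = GameB ->
    eigform rho s (y n.+1) = lam * eigform rho s (y n).
  by move=> gB; rewrite yS; have [] := eigform_FB rho01 phi (my n) gB.
have nAB n : greedy rho (y n) = GameA -> greedy rho (y n) = GameB -> False.
  by move=> ->.
case: N tN minN L0 => [|k] tN minN L0.
  constructor 1; split; first exact/simplexB_greedy/(tN 0%N).
  exact: L0.
(* By minimality of N, the turn just before the tail plays A. *)
have gk : greedy rho (y k) = GameA.
  have [gB|//] := B_or_A k; have := minN k; rewrite ltnn => H.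
  suff : false by []. apply: H; apply/asboolP => n; rewrite leq_eqVlt.
  by case/orP => [/eqP <- //|]; exact: tN.
have Lk : eigform rho s (y k) = exitA rho phi.
  by rewrite (exitA_FA phi_large (my k) gk) -yS L0 mul0r subr0.
case: k {tN minN L0} gk Lk => [|j] gk Lk.
  constructor 2; split; first exact: simplexA_greedy.
  exact: exitA_f.
have gj : greedy rho (y j) = GameB.
  by have [//|/FA gB] := B_or_A j; have := nAB _ gk gB.
have Lj : lam * eigform rho s (y j) = exitA rho phi by rewrite -FB.
case: j {Lk} gk gj Lj => [|i] gk gj Lj.
  constructor 3; split; first exact: simplexB_greedy.
  exact: exitA_g.
have gi : greedy rho (y i) = GameB.
  have [//|gA] := B_or_A i.
  by have := not_A_BA rho01 phi_large l0 (hy i) gA Lj.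
have Li : lam ^+ 2 * eigform rho s (y i) = exitA rho phi.
  by rewrite expr2 -mulrA -FB.
case: i {gk Lj} gj gi Li => [|n] gj gi Li.
  constructor 4; split; first exact: simplexB_greedy.
  exact: exitA_h.
(* Turns n+1, n+2, n+3 play B, B, A, and neither game is possible at turn n. *)
exfalso; have [gn|gn] := B_or_A n.
  by have := not_B_BBA rho01 phi_large l0 (hy n) gn gi Li.
by have := not_A_BBA rho01 phi_large l0 (hy n) gn Li.
Qed.

End Regions.

Theorem theorem2 (R : realType) (rho : R) (hrho : 0 < rho < 1) :
  (* (i) *)
  (forall phi : R, 0 < phi <= 2 / 3 ->
    [/\ forall x : 'rV[R]_3, Defs.simplex x -> Defs.eventually_B rho phi x,
        forall x : 'rV[R]_3, Defs.simplex x ->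
          Defs.trajectory rho phi x n @[n --> \oo] --> Defs.piB rho,
        Defs.globally_asymptotically_stable (@Defs.simplex R)
          (fun x : 'rV[R]_3 => x *m Defs.PB rho phi) (Defs.piB rho)
      & forall y : 'rV[R]_3,
          Defs.stationary (Defs.PB rho phi) y <-> y = Defs.piB rho]) /\
  (* (ii) *)
  (forall phi : R, 2 / 3 < phi < 1 ->
    forall x : 'rV[R]_3, Defs.simplex x -> Defs.eventually_B rho phi x ->
      phi < Defs.phi2 rho /\
      [\/ Defs.R1 rho x, Defs.R2 rho phi x, Defs.R3 rho phi x
        | Defs.R4 rho phi x]).
Proof.
split=> phi hphi; last by move=> x; exact: eventually_B_large.
split.
- by move=> x /simplex_mass_one; exact: eventually_B_small.
- by move=> x /simplex_mass_one; exact: trajectory_cvg.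
- exact: mulPB_stable.
- exact: stationaryP.
Qed.
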